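(* Let $\mathbb{H}$ be an ordered connected hypergraph. The preorder on the set of constructions of $\mathbb{H}$ generated by the flip relation $<$ (i.e. its reflexive and transitive closure) is a partial order, and it is well-founded.
   Context: **Hypergraphs.** A hypergraph $\mathbb{H}$ consists of a finite set $H$ of vertices and a set $\mathbb{H}\subseteq\mathcal{P}(H)\setminus\{\emptyset\}$ of hyperedges with $\bigcup\mathbb{H}=H$; it is always assumed atomic, i.e. $\{x\}\in\mathbb{H}$ for all $x\in H$. It is ordered if $H$ carries a total order. For $X\subseteq H$ put $\mathbb{H}_X=\{Z\in\mathbb{H}\mid Z\subseteq X\}$ and $\mathbb{H}\setminus X=\mathbb{H}_{H\setminus X}$. $\mathbb{H}$ is connected if $H\neq\emptyset$ and there is no partition $H=X_1\sqcup X_2$ into non-empty sets with $\mathbb{H}=\mathbb{H}_{X_1}\cup\mathbb{H}_{X_2}$. $\mathbb{H},X\leadsto H_1,\dots,H_n$ means that $H_1,\dots,H_n$ are the (vertex sets of the) connected components of $\mathbb{H}\setminus X$. **Constructs.** Constructs of a connected hypergraph $\mathbb{H}$ are non-planar rooted trees defined inductively: the one-node tree decorated by $H$ is a construct; if $\emptyset\ne Y\subseteq H$, $\mathbb{H},Y\leadsto H_1,\dots,H_n$ and $T_i$ is a construct of $\mathbb{H}_{H_i}$ for each $i$, then the tree $Y(T_1,\dots,T_n)$ with root decorated by $Y$ and the $T_i$ grafted on it is a construct. A construction is a construct all of whose nodes are decorated by singletons (written as elements). **Flip relation.** Let $S$ be a construction with a node $x$ having a child $y$. Contracting the edge between $x$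 and $y$ and labelling the resulting node $\{x,y\}$ gives a construct with a single non-singleton node; exactly one other construction $T\neq S$ gives the same construct by contracting an edge, and in $T$ the node $x$ is a child of $y$ (the subtree $x(y(\cdots),\cdots)$ of $S$ is replaced by $y(x(\cdots),\cdots)$). One sets $S<T$ if $x<y$ in $H$. *)

(* Defs.v *)
From Stdlib Require Import Relations Wellfounded.
From HB Require Import structures.
From mathcomp Require Import all_boot all_order.

Set Implicit Arguments.
Unset Strict Implicit.
Unset Printing Implicit Defensive.

Import Order.TTheory.

(* The vertex set is a subset of an ambient finite type [T], so that the
   restrictions of a hypergraph live on the same type; an order on [T] induces
   the order on the vertices. *)
Record hypergraph (T : finType) := Hypergraph {
  vert : {set T};
  edges : {set {set T}};
  edges_neq0 : set0 \notin edges;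
  edges_cover : cover edges = vert;
  edges_atomic : [forall x in vert, [set x] \in edges]
}.

Section Restriction.
Variables (T : finType) (G : hypergraph T) (X : {set T}).

(* [P ::&: X] is the set of the members of [P] that are subsets of [X]. *)
Fact restrict_neq0 : set0 \notin edges G ::&: X.
Proof. by rewrite inE negb_and (edges_neq0 G). Qed.

Fact restrict_cover : cover (edges G ::&: X) = vert G :&: X.
Proof.
apply/setP=> x; rewrite inE; apply/bigcupP/andP=> [[Z] | [xG xX]].
  rewrite inE => /andP[ZG /subsetP ZX] xZ; split; last exact: ZX.
  by rewrite -(edges_cover G); apply/bigcupP; exists Z.
exists [set x]; last exact: set11.
by rewrite inE sub1set xX andbT; move/forall_inP: (edges_atomic G); apply.
Qed.

Fact restrict_atomic :
  [forall x in vert G :&: X, [set x] \in edges G ::&: X].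
Proof.
apply/forall_inP=> x /setIP[xG xX]; rewrite inE sub1set xX andbT.
by move/forall_inP: (edges_atomic G); apply.
Qed.

Definition restrict : hypergraph T :=
  Hypergraph restrict_neq0 restrict_cover restrict_atomic.

End Restriction.

Definition remove (T : finType) (G : hypergraph T) (X : {set T}) :=
  restrict G (vert G :\: X).

Definition connected (T : finType) (G : hypergraph T) : bool :=
  (vert G != set0) &&
  ~~ [exists X1 : {set T}, exists X2 : {set T},
       [&& X1 != set0, X2 != set0, [disjoint X1 & X2], X1 :|: X2 == vert G
         & edges G == edges (restrict G X1) :|: edges (restrict G X2)]].

(* Vertex sets of the connected components: the maximal sets of vertices that
   induce a connected hypergraph. *)
Definition components (T : finType) (G : hypergraph T) : {set {set T}} :=
  [set X | maxset (fun Z => (Z \subset vert G) && connected (restrict G Z)) X].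

(* Rooted trees with nodes decorated by sets.  The children of a node are
   indexed by sets instead of being listed in some order: in a construct, each
   child is indexed by the component that it is a construct of.  Hence equality
   of constructs is equality of non-planar trees. *)
Inductive tree (T : finType) : Type :=
  Node of {set T} & {ffun {set T} -> option (tree T)}.

Definition root (T : finType) (t : tree T) : {set T} := let: Node Y _ := t in Y.

Definition leaf (T : finType) (Y : {set T}) : tree T := Node Y [ffun=> None].

Definition graft (T : finType) (Y : {set T}) (P : {set {set T}})
    (t : {set T} -> tree T) : tree T :=
  Node Y [ffun X => if X \in P then Some (t X) else None].

Inductive is_construct (T : finType) (G : hypergraph T) : tree T -> Prop :=
| ConstructLeaf : connected G -> is_construct G (leaf (vert G))
| ConstructGraft (Y : {set T}) (t : {set T} -> tree T) :
    connected G -> Y != set0 -> Y \subset vert G ->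
    (forall X, X \in components (remove G Y) ->
       is_construct (restrict G X) (t X)) ->
    is_construct G (graft Y (components (remove G Y)) t).

Inductive subtree (T : finType) (s : tree T) : tree T -> Prop :=
| SubtreeRefl : subtree s s
| SubtreeChild (Y : {set T}) (f : {ffun {set T} -> option (tree T)})
    (X : {set T}) (t : tree T) :
    f X = Some t -> subtree s t -> subtree s (Node Y f).

Definition is_construction (T : finType) (G : hypergraph T) (t : tree T) :=
  is_construct G t /\ forall s, subtree s t -> exists x, root s = [set x].

Definition construction (T : finType) (G : hypergraph T) : Type :=
  {t : tree T | is_construction G t}.

(* Children of the node obtained by merging a node whose children are given by
   [f] with its child of index [X], whose own children are given by [g].  In a
   construct, the indices of [g] are proper subsets of [X] and those of [f] are
   disjoint, so that no child is lost. *)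
Definition merge_children (T : finType) (f g : {ffun {set T} -> option (tree T)})
    (X : {set T}) : {ffun {set T} -> option (tree T)} :=
  [ffun Z => if g Z is Some u then Some u else if Z == X then None else f Z].

(* [contract A B S C]: contracting in [S] an edge from a node decorated by [A]
   to a child decorated by [B] gives [C]. *)
Inductive contract (T : finType) (A B : {set T}) : tree T -> tree T -> Prop :=
| ContractRoot (f g : {ffun {set T} -> option (tree T)}) (X : {set T}) :
    f X = Some (Node B g) ->
    contract A B (Node A f) (Node (A :|: B) (merge_children f g X))
| ContractChild (Y : {set T}) (f : {ffun {set T} -> option (tree T)})
    (X : {set T}) (s s' : tree T) :
    f X = Some s -> contract A B s s' ->
    contract A B (Node Y f)
      (Node Y [ffun Z => if Z == X then Some s' else f Z]).

Definition flip_lt d (T : finOrderType d) (G : hypergraph T)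
    (S S' : construction G) : Prop :=
  exists (x y : T) (C : tree T),
    [/\ contract [set x] [set y] (sval S) C,
        S' <> S,
        exists A B, contract A B (sval S') C
      & (x < y)%O].

Definition flip_le d (T : finOrderType d) (G : hypergraph T) :
    construction G -> construction G -> Prop :=
  clos_refl_trans (construction G) (@flip_lt d T G).

(* Main.v *)
Require Import Defs.
From Stdlib Require Import Relations Wellfounded.
From HB Require Import structures.
From mathcomp Require Import all_boot all_order.
From Stdlib Require Import ProofIrrelevance Wf_nat.
From mathcomp Require Import zify.


(** Both claims follow from a natural number attached to each construction that
    every flip [S < T] strictly increases: a chain of flips that comes back to
    its start is then empty, and the numbers below a given one leave no room for
    an infinite descent.

    The number is the sum, over the nodes of [S], of [n ^ r] times the number of
    nodes of the subtree hanging there, where [r] is the rank in the order of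
    the vertex decorating the node and [n] is the number of nodes of [S].
    A flip replaces a subtree [x(y(...),...)] with [m] nodes by
    [y(x(...),...)], which hangs the same subtrees below the edge, hence also
    has [m] nodes.  Every node other than [x] and [y] keeps the size of its
    subtree; that of [y] grows to [m], and that of [x] drops from [m] to at
    least 1.  Since [x < y], the weight of [y] is at least [n] times the weight
    of [x], while [m <= n], so the gain at [y] exceeds the loss at [x]
    ([flip_root_weight], carried to any depth by [flip_weight]).

    Two points need the geometry of the hypergraph.  Contracting an edge loses
    no subtree, because the components of a hypergraph form an antichain for
    inclusion ([grandchildren_disjoint]).  And if two distinct constructions
    contract to the same construct, they do so at the same place and with the
    two labels exchanged: the place is the unique node with a non-singleton
    label ([contract_not_construction]), and the orientation of the edge
    determines the construction ([merge_children_inj]). *)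

Set Implicit Arguments.
Unset Strict Implicit.
Unset Printing Implicit Defensive.

Import Order.TTheory.

(** * Sums over finite functions in structural recursion *)

Section FinfunSum.
Variables (I : finType) (V : Type) (F : V -> nat).

(** The recursion runs over the internal enumeration of [f]: the guard condition
    sees the values of [f] as subterms there, but does not see [u] as a subterm
    when [f X = Some u]. *)
Fixpoint finfun_on_sum (r : seq I) (h : finfun_on (fun=> V) r) : nat :=
  if h is finfun_cons _ _ v h' then F v + finfun_on_sum h' else 0.

Definition finfun_sum (f : {ffun I -> V}) : nat :=
  let: FinfunOf h := f in finfun_on_sum h.

Lemma finfun_sumE f : finfun_sum f = \sum_i F (f i).
Proof.
rewrite -[f in LHS]ffunK unlock /= -big_enum /=.
elim: (enum I) => [|i r IH]; first by rewrite big_nil.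
by rewrite big_cons -IH.
Qed.

End FinfunSum.

(** * Contraction of an edge of a construction *)

Section Trees.
Variable T : finType.
Implicit Types (A B Y X Z : {set T}) (G : hypergraph T) (s t S C : tree T).
Implicit Types (f g : {ffun {set T} -> option (tree T)}).

Lemma components_antichain G X Z :
  X \in components G -> Z \in components G -> Z \subset X -> X = Z.
Proof.
rewrite !inE => /maxsetP[Xconn _] /maxsetP[_ Zmax] ZX.
exact: Zmax.
Qed.

Lemma component_sub G X : X \in components G -> X \subset vert G.
Proof. by rewrite inE => /maxsetP[/andP[]]. Qed.

Lemma components_removeT G : components (remove G (vert G)) = set0.
Proof.
apply/setP=> X; rewrite !inE; apply/negbTE/negP=> /maxsetP[/andP[_]].
by rewrite /connected /= setDv setI0 set0I eqxx.
Qed.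

(** The one-node tree on a hypergraph [G] fits the same description as the other
    constructions, because removing all the vertices leaves no component. *)
Lemma constructionE G Y f : is_construction G (Node Y f) ->
  [/\ exists2 x, x \in vert G & Y = [set x],
      forall X, f X = (X \in components (remove G Y)) :> bool
    & forall X t, f X = Some t -> is_construction (restrict G X) t].
Proof.
case=> Gt roots.
have subP X t : f X = Some t -> forall s, subtree s t ->
    exists x, Defs.root s = [set x].
  by move=> fX s st; apply: roots; apply: SubtreeChild fX st.
have [x /= Yx] := roots _ (SubtreeRefl _).
have {Gt}[Y0 fP] : Y \subset vert G /\ (forall X, (f X : bool) =
  (X \in components (remove G Y)) /\
  forall t, f X = Some t -> is_construct (restrict G X) t).
  move eS: (Node Y f) => S in Gt.
  case: Gt eS => [_ [-> ->]|Y' t _ _ YG Ht [-> ->]].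
    by split=> // X; rewrite components_removeT inE ffunE.
  split=> // X; rewrite ffunE; case: ifP => HX; split=> // u [<-]; exact: Ht.
split; last by move=> X t fX; split; [apply: (fP X).2 | apply: subP fX].
  by exists x => //; move: Y0; rewrite Yx sub1set.
by move=> X; case: (fP X).
Qed.

Lemma child_root_sub G A B f g X :
    is_construction G (Node A f) -> f X = Some (Node B g) ->
  exists2 y, [/\ y \in X & y \notin A] & B = [set y].
Proof.
move=> /constructionE[_ domf chf] fX.
have /constructionE[[y]] := chf _ _ fX.
rewrite /= => /setIP[yG yX] By _ _; exists y => //; split=> //.
have /component_sub/subsetP/(_ y yX) : X \in components (remove G A).
  by rewrite -domf fX.
by rewrite /= !inE => /and3P[].
Qed.

(** A common index [Z] of a child and of a grandchild below [X] would be a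
    component contained in the component [X], hence [X] itself; but [Z] avoids
    the label of the child, which lies in [X].  This is what makes
    [merge_children] lossless. *)
Lemma grandchildren_disjoint G A B f g X Z :
    is_construction G (Node A f) -> f X = Some (Node B g) -> f Z -> g Z = None.
Proof.
move=> SG fX fZ; have [y [yX _] By] := child_root_sub SG fX.
have [_ domf chf] := constructionE SG.
have [_ domg _] := constructionE (chf _ _ fX).
case gZ: (g Z) => [u|//].
have /subsetP ZX : Z \subset (vert G :&: X) :\: B.
  have /component_sub ZX : Z \in components (remove (restrict G X) B).
    by rewrite -domg gZ.
  exact: subset_trans ZX (subsetIr _ _).
have eXZ : X = Z.
  apply: (@components_antichain (remove G A)); rewrite -?domf ?fX //.
  by apply/subsetP=> z /ZX; rewrite !inE => /and3P[].
by have := ZX y; rewrite -eXZ yX By !inE eqxx => /(_ isT).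
Qed.

(** Once the two labels and their order are fixed, the indices of the children
    are components read off the hypergraph, so that each merged child can be
    put back where it came from. *)
Lemma merge_children_inj G A B f g f' g' X X' :
    is_construction G (Node A f) -> f X = Some (Node B g) ->
    is_construction G (Node A f') -> f' X' = Some (Node B g') ->
    merge_children f g X = merge_children f' g' X' ->
  f = f'.
Proof.
move=> SG fX SG' fX' /ffunP eqh.
have gN := grandchildren_disjoint SG fX.
have gN' := grandchildren_disjoint SG' fX'.
have [_ domf chf] := constructionE SG.
have [_ domf' chf'] := constructionE SG'.
have [_ domg _] := constructionE (chf _ _ fX).
have [_ domg' _] := constructionE (chf' _ _ fX').
(* If [X] and [X'] differ, the child at [X'] survives the first merge, while the
   second one leaves nothing at [X']. *)
have eqX : X = X'.
  apply/eqP; case: eqP => // /eqP; rewrite eq_sym => neX.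
  have := eqh X'; rewrite !ffunE gN' ?fX' // eqxx (negbTE neX).
  have fX1 : f X' by rewrite domf -domf' fX'.
  by rewrite gN //; case: (f X') fX1.
subst X'.
have eqg : g = g'.
  apply/ffunP=> Z; have := eqh Z; rewrite !ffunE.
  have := domg Z; rewrite -domg'.
  by case: (g Z) => [u|]; case: (g' Z).
apply/ffunP=> Z; have [->|neZ] := eqVneq Z X; first by rewrite fX fX' eqg.
have := eqh Z; rewrite !ffunE (negbTE neZ).
have := domf Z; rewrite -domf' => domZ.
case fZ : (f Z) domZ => [u|] domZ.
  by rewrite gN ?fZ // gN' -?domZ.
by case: (f' Z) domZ.
Qed.

(** * The weight of a tree *)

Fixpoint tree_size t : nat :=
  let: Node _ f := t in (finfun_sum (oapp tree_size 0) f).+1.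

Fixpoint weight (w : {set T} -> nat) t : nat :=
  let: Node Y f := t in
  w Y * tree_size t + finfun_sum (oapp (weight w) 0) f.

Definition children_sum (F : tree T -> nat) f : nat := \sum_X oapp F 0 (f X).

Lemma tree_sizeE Y f :
  tree_size (Node Y f) = (children_sum tree_size f).+1.
Proof. by rewrite /= finfun_sumE. Qed.

Lemma weightE w Y f : weight w (Node Y f) =
  w Y * tree_size (Node Y f) + children_sum (weight w) f.
Proof. by rewrite /children_sum -finfun_sumE. Qed.

Lemma children_sum_merge F G A B f g X :
    is_construction G (Node A f) -> f X = Some (Node B g) ->
  children_sum F (merge_children f g X) + F (Node B g)
    = children_sum F f + children_sum F g.
Proof.
move=> SG fX; rewrite -(big_pred1_eq addn X (fun=> F (Node B g))) big_mkcond.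
rewrite /children_sum -!big_split /=; apply: eq_bigr => Z _; rewrite ffunE.
have := grandchildren_disjoint (Z := Z) SG fX.
have [->|neZ] := eqVneq Z X; first by rewrite fX => -> //; rewrite addn0.
case: (f Z) => [u -> //|_].
by rewrite addn0; case: (g Z).
Qed.

Lemma children_sum_update F f X s s' : f X = Some s ->
  children_sum F [ffun Z => if Z == X then Some s' else f Z] + F s
    = children_sum F f + F s'.
Proof.
move=> fX; rewrite -(big_pred1_eq addn X (fun=> F s)).
rewrite -(big_pred1_eq addn X (fun=> F s')) !(big_mkcond (pred1 X)).
rewrite /children_sum -!big_split /=; apply: eq_bigr => Z _; rewrite ffunE.
by have [->|//] := eqVneq Z X; rewrite fX addnC.
Qed.

(** * Locating the contracted edge *)

Lemma contracted_label A B S C : contract A B S C ->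
  exists2 u, subtree u C & Defs.root u = A :|: B.
Proof.
elim=> [f g X fX|Y f X s s' fX _ [u us' uAB]].
  by eexists; first exact: SubtreeRefl.
by exists u => //; apply: (@SubtreeChild _ _ _ _ X s') us'; rewrite ffunE eqxx.
Qed.

Lemma contract_labels G A B S C : is_construction G S -> contract A B S C ->
  exists a b, [/\ a != b, A = [set a] & B = [set b]].
Proof.
move=> SG cS; elim: cS G SG => [f g X fX|Y f X s s' fX _ IH] G SG.
  have [y [_ yA] By] := child_root_sub SG fX.
  have [[a _ Aa] _ _] := constructionE SG.
  by exists a, y; split=> //; apply: contraNneq yA => <-; rewrite Aa set11.
by have [_ _ chf] := constructionE SG; apply: IH (chf _ _ fX).
Qed.

Lemma contracted_label_neq1 G A B S C z :
  is_construction G S -> contract A B S C -> A :|: B <> [set z].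
Proof.
move=> SG /(contract_labels SG)[a [b [neab -> ->]]] eqz.
by have := congr1 (fun D : {set T} => #|D|) eqz; rewrite cards2 neab cards1.
Qed.

(** The contracted node is decorated by two vertices.  Hence a contraction
    inside one child can only be matched by a contraction inside the same child. *)
Lemma contract_not_construction G G' A B S C :
  is_construction G S -> contract A B S C -> ~ is_construction G' C.
Proof.
move=> SG cS [_ roots]; have [u uC uAB] := contracted_label cS.
by have [z] := roots u uC; rewrite uAB => /(contracted_label_neq1 SG cS).
Qed.

(** * Effect of a flip on the weight *)

Lemma tree_size_child f X s Y :
  f X = Some s -> tree_size s < tree_size (Node Y f).
Proof.
by move=> fX; rewrite tree_sizeE ltnS /children_sum (bigD1 X) //= fX leq_addr.
Qed.

(** With [m] the common size of the two trees, [k] the size of the child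
    labelled by [y] in the first one and [k'] that of the child labelled by [x]
    in the second one, the weight grows by
    [w y * (m - k) - w x * (m - k')], where [m - k >= 1] and [m - k' < m]. *)
Lemma flip_root_weight w G G' f g f' g' X X' x y :
    is_construction G (Node [set x] f) -> f X = Some (Node [set y] g) ->
    is_construction G' (Node [set y] f') -> f' X' = Some (Node [set x] g') ->
    merge_children f g X = merge_children f' g' X' ->
    0 < w [set x] -> tree_size (Node [set x] f) * w [set x] <= w [set y] ->
  tree_size (Node [set y] f') = tree_size (Node [set x] f) /\
  weight w (Node [set x] f) < weight w (Node [set y] f').
Proof.
move=> SG fX SG' fX' eqh w0 wxy.
have szM := children_sum_merge tree_size SG fX.
have szM' := children_sum_merge tree_size SG' fX'.
have wM := children_sum_merge (weight w) SG fX.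
have wM' := children_sum_merge (weight w) SG' fX'.
have lt_sz := tree_size_child [set x] fX.
rewrite -eqh in szM' wM'; move: wM wM'.
rewrite !weightE.
move: szM szM' lt_sz wxy; rewrite !tree_sizeE.
set h := merge_children f g X.
move: (children_sum _ h) (children_sum (weight w) h) => hn hw.
move: (children_sum _ f) (children_sum (weight w) f) => fn fw.
move: (children_sum _ g) (children_sum (weight w) g) => gn gw.
move: (children_sum _ f') (children_sum (weight w) f') => fn' fw'.
move: (children_sum _ g') (children_sum (weight w) g') => gn' gw'.
move: (w _) (w _) w0 => wx wy w0 *.
have e : fn' = fn by lia.
split; [by rewrite e | subst fn'; nia].
Qed.

(** Equality of the sizes is carried along because the weight of a node above
    the flipped edge involves the size of the whole tree below it. *)
Lemma flip_weight w n x y S C :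
    contract [set x] [set y] S C -> 0 < w [set x] ->
    n * w [set x] <= w [set y] -> tree_size S <= n ->
  forall G A B S', is_construction G S -> is_construction G S' ->
    contract A B S' C -> S' <> S ->
  tree_size S' = tree_size S /\ weight w S < weight w S'.
Proof.
move=> cS w0 wxy.
elim: cS => [f g X fX|Y f X s s' fX cs IH] leSn G A B S' SG SG'.
  move eC: (Node _ _) => C' cS'.
  case: cS' (cS') SG' eC => [f' g' X' fX'|Y' f' X' u u' fX' cu] cS' SG' [eY eh]
    neS.
    have [a [b [neab Aa Bb]]] := contract_labels SG' cS'; subst A B.
    have xab : x \in [set a; b] by rewrite -eY set21.
    have axy : a \in [set x; y] by rewrite eY set21.
    have bxy : b \in [set x; y] by rewrite eY set22.
    (* If the root is [x] in both trees, then the trees are equal. *)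
    have [eax|neax] := eqVneq a x.
      subst a; case: neS; have eyb : y = b.
        by move: bxy; rewrite !inE eq_sym (negbTE neab) => /eqP.
      by subst b; rewrite (merge_children_inj SG fX SG' fX' eh).
    have eay : a = y by move: axy; rewrite !inE (negbTE neax) => /eqP.
    have ebx : b = x.
      by move: xab; rewrite !inE eq_sym (negbTE neax) => /eqP.
    subst a b; apply: (flip_root_weight SG fX SG' fX' eh w0).
    by apply: leq_trans wxy; rewrite leq_mul2r leSn orbT.
  (* A contraction below the root of [S'] would leave its singleton label at the
     root of [C], which carries two vertices. *)
  have [[z _ Yz] _ _] := constructionE SG'.
  by case: (contracted_label_neq1 SG (ContractRoot _ fX) (etrans eY Yz)).
move eC: (Node _ _) => C' cS'.
case: cS' (cS') SG' eC => [f' g' X' fX'|Y' f' X' u u' fX' cu] cS' SG' [eY eh]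
  neS.
  have [[z _ Yz] _ _] := constructionE SG.
  by case: (contracted_label_neq1 SG' cS' (etrans (esym eY) Yz)).
subst Y'.
have [_ _ chf] := constructionE SG.
have [_ _ chf'] := constructionE SG'.
have [eX|neX] := eqVneq X X'; last first.
  have /ffunP/(_ X) := eh; rewrite !ffunE eqxx (negbTE neX) => /esym /chf'.
  by case/(contract_not_construction (chf _ _ fX) cs).
subst X'; have eu : s' = u'.
  by have /ffunP/(_ X) := eh; rewrite !ffunE eqxx => -[].
subst u'.
have ef' : f' = [ffun Z => if Z == X then Some u else f Z].
  apply/ffunP=> Z; have /ffunP/(_ Z) := eh; rewrite !ffunE.
  by have [->|] := eqVneq Z X.
have neu : u <> s.
  move=> eu; apply: neS; congr Node; rewrite ef' eu.
  by apply/ffunP=> Z; rewrite ffunE; have [->|] := eqVneq Z X.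
have les : tree_size s <= n.
  exact: leq_trans (ltnW (tree_size_child Y fX)) leSn.
have [eqsz ltw] := IH les _ _ _ _ (chf _ _ fX) (chf' _ _ fX') cu neu.
have szU := children_sum_update tree_size u fX.
have wU := children_sum_update (weight w) u fX.
have eqfsz : children_sum tree_size f' = children_sum tree_size f.
  by apply/eqP; rewrite -(eqn_add2r (tree_size s)) ef' szU eqsz.
rewrite !weightE !tree_sizeE eqfsz; split=> //.
by rewrite ltn_add2l -(ltn_add2r (weight w s)) ef' wU ltn_add2l.
Qed.

End Trees.

(** * The potential of a construction *)

Section Flips.
Variables (d : Order.disp_t) (T : finOrderType d) (G : hypergraph T).
Implicit Types S : construction G.

Definition rank (x : T) : nat := #|[set z | (z < x)%O]|.

Lemma rank_lt x y : (x < y)%O -> rank x < rank y.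
Proof.
move=> xy; apply: proper_card; apply/properP; split.
  by apply/subsetP=> z; rewrite !inE => /lt_trans; apply.
by exists x; rewrite !inE ?ltxx.
Qed.

Definition rank_weight (n : nat) (Y : {set T}) : nat :=
  \sum_(x in Y) n ^ rank x.

(** The base of the powers can be the size of the construction itself, because
    flips preserve the size. *)
Definition potential S : nat :=
  weight (rank_weight (tree_size (sval S))) (sval S).

(** Proof irrelevance turns the inequality of two constructions into the
    inequality of the underlying trees. *)
Lemma flip_lt_potential S S' : flip_lt S S' -> potential S < potential S'.
Proof.
case=> x [y [C [cS neS [A [B cS']] xy]]].
have ne : sval S' <> sval S.
  case: S S' {cS cS'} neS => [s sG] [s' sG'] /= neS es; apply: neS.
  exact: subset_eq_compat.
set n := tree_size (sval S).
have n0 : 0 < n by rewrite /n; case: (sval S).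
have w0 : 0 < rank_weight n [set x].
  by rewrite /rank_weight big_set1 expn_gt0 n0.
have wxy : n * rank_weight n [set x] <= rank_weight n [set y].
  by rewrite /rank_weight !big_set1 -expnS leq_pexp2l // rank_lt.
have [eqsz ltw] :=
  flip_weight cS w0 wxy (leqnn n) (svalP S) (svalP S') cS' ne.
by rewrite /potential eqsz.
Qed.

Lemma flip_le_potential S S' :
  flip_le S S' -> S = S' \/ potential S < potential S'.
Proof.
elim=> [S1 S2 /flip_lt_potential|S1|S1 S2 S3 _ [-> //|lt12] _ [<-|lt23]].
- by right.
- by left.
- by right.
- by right; apply: ltn_trans lt23.
Qed.

End Flips.

Theorem proposition3p18 (d : Order.disp_t) (T : finOrderType d)
    (G : hypergraph T) (G_connected : connected G) :
  Relation_Definitions.order (construction G) (@flip_le d T G) /\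
  well_founded (fun S S' : construction G => flip_le S S' /\ S <> S').
Proof.
split.
  split=> [S|S1 S2 S3|S S' le le']; first exact: rt_refl.
    exact: rt_trans.
  have [//|lt] := flip_le_potential le; have [//|lt'] := flip_le_potential le'.
  by have := ltn_trans lt lt'; rewrite ltnn.
apply: (well_founded_lt_compat _ (@potential d T G)) => S S' [le neS].
by apply/ssrnat.ltP; case: (flip_le_potential le).
Qed.
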